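(* Let $r\ge 2$ and $n\ge 1$ be integers and let $0\le c_1\le c_2\le\cdots\le c_r$ be letter lengths. Let $m^*$ be the minimum number of non-terminals in any optimal tree (with $n$ terminals). Then any shallow tree (with $n$ terminals) having exactly $m^*$ non-terminals is optimal and proper.
   Context: The infinite $r$-ary tree is the infinite rooted tree in which every node has exactly $r$ ordered children; the edge from a node to its $i$th child has length $c_i$. A node means a node of this infinite tree; $\mathrm{depth}(u)$ is the sum of the edge lengths on the path from the root to $u$. A tree is a subtree $T$ of the infinite $r$-ary tree containing the root, in which $n$ of the leaves are designated as terminals; all the other nodes of $T$ are called non-terminals (a non-terminal is allowed to have no children in $T$). The cost $c(T)$ is the sum of the depths of the terminals of $T$. A tree is optimal if it has minimum cost among all trees with $n$ terminals. A tree is proper if every non-terminal has at least two children in the tree. A tree $T$ is shallow if (i) for any non-terminal $u\in T$ and any node $w$ (not necessarily in $T$) that is not a non-terminal of $T$, $\mathrm{depth}(u)\le\mathrm{depth}(w)$; and (ii) for any terminal $u\in T$ and any node $w$ that is not in $T$ but is a child of a non-terminal of $T$, $\mathrm{depth}(u)\le\mathrm{depth}(w)$. *)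

(* Defs.v *)
From mathcomp Require Import all_boot all_order all_algebra.
From mathcomp Require Import finmap.
From mathcomp Require Import boolp classical_sets functions cardinality reals.

Set Implicit Arguments.
Unset Strict Implicit.
Unset Printing Implicit Defensive.

Import Order.TTheory GRing.Theory Num.Theory.
Local Open Scope ring_scope.
Local Open Scope classical_set_scope.
Local Open Scope card_scope.

(* A node of the infinite r-ary tree is the sequence of child indices on the
   path from the root: [::] is the root, rcons u i is the i-th child of u
   (indices start at 0). *)
Notation node r := (seq 'I_r).

Definition depth (R : realType) (r : nat) (c : 'I_r -> R) (u : node r) : R :=
  \sum_(i <- u) c i.

(* The node set may be infinite: only the number of terminals is prescribed. *)
Record tree (r n : nat) := Tree {
  nodes :> set (node r);
  terminals : {fset node r};
  tree_root : nodes [::];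
  tree_parent : forall (u : node r) (i : 'I_r), nodes (rcons u i) -> nodes u;
  terminals_in : forall u : node r, u \in terminals -> nodes u;
  terminals_leaf : forall (u : node r) (i : 'I_r),
    u \in terminals -> ~ nodes (rcons u i);
  card_terminals : #|` terminals | = n
}.

Definition nonterminals (r n : nat) (T : tree r n) : set (node r) :=
  [set u | nodes T u /\ u \notin terminals T].

Definition cost (R : realType) (r n : nat) (c : 'I_r -> R) (T : tree r n) : R :=
  \sum_(u <- terminals T) depth c u.

Definition optimal (R : realType) (r n : nat) (c : 'I_r -> R) (T : tree r n) :
    Prop :=
  forall T' : tree r n, cost c T <= cost c T'.

Definition proper_tree (r n : nat) (T : tree r n) : Prop :=
  forall u : node r, nonterminals T u ->
    exists i j : 'I_r, [/\ i != j, nodes T (rcons u i) & nodes T (rcons u j)].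

Definition shallow (R : realType) (r n : nat) (c : 'I_r -> R) (T : tree r n) :
    Prop :=
  (forall u w : node r, nonterminals T u -> ~ nonterminals T w ->
     depth c u <= depth c w) /\
  (forall (u v : node r) (i : 'I_r), u \in terminals T ->
     nonterminals T v -> ~ nodes T (rcons v i) ->
     depth c u <= depth c (rcons v i)).

Definition min_nonterminals (R : realType) (r n : nat) (c : 'I_r -> R)
    (m : nat) : Prop :=
  (exists T : tree r n, optimal c T /\ nonterminals T #= `I_m) /\
  (forall (T : tree r n) (k : nat),
     optimal c T -> nonterminals T #= `I_k -> (m <= k)%N).

(* Main.v *)
(* An optimal tree with the least number of non-terminals is proper, since
   otherwise a non-terminal with at most one child could be contracted away.
   If such a tree M and a tree T with the m shallowest non-terminals differ,
   take a non-terminal u of T that is not one of M although its parent is, and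
   a non-terminal w of M that is not one of T.  Then depth u <= depth w, and
   exchanging the subtrees of M at u and w keeps it optimal: the subtree at u is
   at most a single terminal, which may sink, but at least one terminal below w
   rises by the same amount.  Iterating, M gets the same non-terminals as T, and
   then condition (ii) says that the terminals of T are the best possible. *)
Require Import Defs.
From mathcomp Require Import all_boot all_order all_algebra.
From mathcomp Require Import finmap.
From mathcomp Require Import boolp classical_sets functions cardinality reals.
From mathcomp Require Import lra.

Import Order.TTheory GRing.Theory Num.Theory.
Local Open Scope ring_scope.
Local Open Scope classical_set_scope.
Local Open Scope card_scope.

(** * Depths of words, and moving subtrees by rewriting prefixes *)

Lemma depth_cat {R : realType} {r : nat} (c : 'I_r -> R) (u v : node r) :
  depth c (u ++ v) = depth c u + depth c v.
Proof. by rewrite /depth big_cat. Qed.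

Lemma depth_rcons {R : realType} {r : nat} (c : 'I_r -> R) (u : node r) i :
  depth c (rcons u i) = depth c u + c i.
Proof. by rewrite -cats1 depth_cat /depth big_seq1. Qed.

(** Moves the whole subtree at [u] to the position [w] and leaves all other words in place, so words
    may collide below [w]. *)
Definition graft {T : eqType} (u w x : seq T) : seq T :=
  if prefix u x then w ++ drop (size u) x else x.

Lemma graft_cat {T : eqType} (u w s : seq T) : graft u w (u ++ s) = w ++ s.
Proof. by rewrite /graft prefix_prefix drop_size_cat. Qed.

Lemma graft_id {T : eqType} (u w x : seq T) :
  ~~ prefix u x -> graft u w x = x.
Proof. by rewrite /graft => /negbTE->. Qed.

(** Meant for [u] and [w] neither of which is a prefix of the other: no word then lies below both,
    and the order of the tests is immaterial. *)
Definition subtree_swap {T : eqType} (u w x : seq T) : seq T :=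
  if prefix u x then graft u w x else graft w u x.

Section SubtreeSwap.
Context {T : eqType} {u w : seq T}.
Hypothesis uw : ~~ prefix u w.
Hypothesis wu : ~~ prefix w u.

(** Of two prefixes of the same word, the shorter is a prefix of the longer. *)
Lemma prefix_incomparable (x : seq T) : prefix u x -> ~~ prefix w x.
Proof.
move=> /prefixP[s ->]; apply/negP => /prefixP[t E].
have [le|le] := leqP (size u) (size w).
- move/negP: uw; apply; rewrite prefixE.
  by rewrite -(takel_cat t le) -E take_size_cat.
- move/negP: wu; apply; rewrite prefixE.
  by rewrite -(takel_cat s (ltnW le)) E take_size_cat.
Qed.

Lemma subtree_swapl (s : seq T) : subtree_swap u w (u ++ s) = w ++ s.
Proof. by rewrite /subtree_swap prefix_prefix graft_cat. Qed.

Lemma subtree_swapr (s : seq T) : subtree_swap u w (w ++ s) = u ++ s.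
Proof.
rewrite /subtree_swap ifN ?graft_cat //.
by apply: contraL (prefix_prefix w s); apply: prefix_incomparable.
Qed.

Lemma subtree_swap_id (x : seq T) :
  ~~ prefix u x -> ~~ prefix w x -> subtree_swap u w x = x.
Proof. by move=> ux wx; rewrite /subtree_swap (negbTE ux) graft_id. Qed.

Lemma subtree_swapK : involutive (subtree_swap u w).
Proof.
move=> x; have [/prefixP[s ->]|ux] := boolP (prefix u x).
  by rewrite subtree_swapl subtree_swapr.
have [/prefixP[s ->]|wx] := boolP (prefix w x).
  by rewrite subtree_swapr subtree_swapl.
by rewrite !subtree_swap_id.
Qed.
End SubtreeSwap.

(** * Finite encoding of trees *)

(* A tree with finitely many non-terminals is encoded by its set N of
   non-terminals and its set L of terminals. *)
Record shape {r : nat} (N L : {fset node r}) : Prop := Shape {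
  shape_disj : [disjoint N & L]%fset;
  shape_root : [::] \in (N `|` L)%fset;
  shape_parent : forall (u : node r) (i : 'I_r),
    rcons u i \in (N `|` L)%fset -> u \in N
}.

Lemma shape_tree {r n : nat} (N L : {fset node r}) :
  shape N L -> #|` L| = n ->
  exists2 T : tree r n, terminals T = L & nonterminals T = [set` N].
Proof.
move=> [NL rt par] Ln.
pose X := [set` (N `|` L)%fset].
have Xp u i : X (rcons u i) -> X u.
  by move=> /par uN; rewrite /X /= inE uN.
have Xin u : u \in L -> X u by move=> uL; rewrite /X /= inE uL orbT.
have Xleaf u i : u \in L -> ~ X (rcons u i).
  by move=> uL /par uN; have := fdisjointP NL u uN; rewrite uL.
exists (@Tree r n X L rt Xp Xin Xleaf Ln) => //.
apply/seteqP; split => u /=; rewrite /nonterminals /X /= inE.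
  by case=> /orP[//|->].
by move=> uN; rewrite uN (fdisjointP NL).
Qed.

Lemma tree_shape {r n m : nat} (T : tree r n) :
  nonterminals T #= `I_m ->
  exists N : {fset node r}, [/\ shape N (terminals T),
    [set` N] = nonterminals T & #|` N| = m].
Proof.
move=> Tm; have Tfin : finite_set (nonterminals T).
  by apply/finite_setP; exists m.
have NE := fset_setK Tfin.
have memN u : (u \in fset_set (nonterminals T)) <-> nonterminals T u.
  by rewrite -[X in _ <-> X u]NE.
exists (fset_set (nonterminals T)); split=> //; last exact: card_fset_set.
have inT u : (u \in (fset_set (nonterminals T) `|` terminals T)%fset) <->
    nodes T u.
  rewrite inE; split=> [/orP[/memN[]//|/terminals_in//]|uT].
  have [uL|uL] := boolP (u \in terminals T); first by rewrite orbT.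
  by rewrite orbF; apply/memN; split.
split.
- by apply/fdisjointP => u /memN[].
- by apply/inT; exact: tree_root.
- move=> u i /inT uiT; apply/memN; split; first exact: tree_parent uiT.
  by apply/negP => /terminals_leaf; apply; exact: uiT.
Qed.

Section ShapeTheory.
Context {r : nat} {N L : {fset node r}}.
Hypothesis NL : shape N L.

Lemma shape_cat (u s : node r) :
  s != [::] -> u ++ s \in (N `|` L)%fset -> u \in N.
Proof.
elim/last_ind: s => [//|s i IH] _; rewrite -rcons_cat => /(shape_parent _ _ NL).
case: (eqVneq s [::]) => [->|s0 usN]; first by rewrite cats0.
by apply: IH; rewrite // inE usN.
Qed.

Lemma shape_prefix (u x : node r) : prefix u x -> x \in N -> u \in N.
Proof.
move=> /prefixP[s ->]; case: (eqVneq s [::]) => [->|s0]; first by rewrite cats0.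
by move=> usN; apply: shape_cat s0 _; rewrite inE usN.
Qed.

Lemma shape_notin (u : node r) : u \in N -> u \notin L.
Proof. exact: (fdisjointP (shape_disj _ _ NL)). Qed.
End ShapeTheory.

(** Common to contraction and exchange. The pair [A], [L] need not be a shape itself, so that a
    contraction can first drop a node. *)
Lemma shape_image {r : nat} (f : node r -> node r) (A L : {fset node r}) :
  [disjoint A & L]%fset -> {in (A `|` L)%fset &, injective f} ->
  [::] \in (f @` (A `|` L))%fset ->
  (forall x y j, x \in (A `|` L)%fset -> f x = rcons y j ->
     y \in (f @` A)%fset) ->
  shape (f @` A)%fset (f @` L)%fset.
Proof.
move=> AL finj rt par; rewrite imfsetU in rt; split=> //.
- apply/fdisjointP => y /imfsetP[a /= aA ->]; apply/imfsetP => -[b /= bL E].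
  have ab : a = b by apply: finj; rewrite // inE ?aA ?bL ?orbT.
  by have := fdisjointP AL a aA; rewrite ab bL.
- move=> y j; rewrite -imfsetU => /imfsetP[x /= xAL E].
  exact: (par x y j).
Qed.

(** * Costs and minimal shapes *)

Definition fcost {R : realType} {r : nat} (c : 'I_r -> R)
    (L : {fset node r}) : R := \sum_(u <- L) depth c u.

Lemma fcost_image {R : realType} {r : nat} (c : 'I_r -> R)
    (f : node r -> node r) (L : {fset node r}) :
  {in L &, injective f} ->
  fcost c (f @` L)%fset = \sum_(u <- L) depth c (f u).
Proof. by move=> finj; rewrite /fcost big_imfset. Qed.

(** Optimality with fewest non-terminals, tested against finite shapes only. In [minimal_card],
    having cost at most that of [L] expresses that the competitor is optimal too. *)
Record minimal {R : realType} {r : nat} (c : 'I_r -> R) (n m : nat)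
    (N L : {fset node r}) : Prop := Minimal {
  minimal_shape : shape N L;
  minimal_cardL : #|` L| = n;
  minimal_cardN : #|` N| = m;
  minimal_cost : forall N' L' : {fset node r}, shape N' L' -> #|` L'| = n ->
    fcost c L <= fcost c L';
  minimal_card : forall N' L' : {fset node r}, shape N' L' -> #|` L'| = n ->
    fcost c L' <= fcost c L -> (m <= #|` N'|)%N
}.

Lemma minimal_of_le {R : realType} {r n m : nat} (c : 'I_r -> R)
    (N L N' L' : {fset node r}) :
  minimal c n m N L -> shape N' L' -> #|` L'| = n -> #|` N'| = m ->
  fcost c L' <= fcost c L -> minimal c n m N' L'.
Proof.
move=> [NL Ln Nm cmin nmin] NL' Ln' Nm' le; split=> // N2 L2 NL2 Ln2.
  exact: le_trans le (cmin _ _ NL2 Ln2).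
by move=> le2; apply: nmin NL2 Ln2 (le_trans le2 le).
Qed.

(** The letter [i] is arbitrary: one use yields some child of [u], and a second use, with [i] the
    letter of that child, yields another. The contraction in the proof also covers a childless [u],
    which is then just deleted. *)
Lemma minimal_proper {R : realType} {r n m : nat} (c : 'I_r -> R)
    (N L : {fset node r}) (u : node r) (i : 'I_r) :
  (forall j, 0 <= c j) -> (1 <= n)%N -> minimal c n m N L -> u \in N ->
  exists2 j, j != i & rcons u j \in (N `|` L)%fset.
Proof.
move=> c0 n0 [NL Ln Nm _ nmin] uN; apply: contrapT => nex.
have uniq_child j : rcons u j \in (N `|` L)%fset -> j = i.
  by move=> uj; apply/eqP/negPn/negP => ji; apply: nex; exists j.
(* f contracts the edge from u to rcons u i, the only child u may have;
   this never increases a depth and removes the non-terminal u. *)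
have [f [fNdown fup]] : exists f : node r -> node r,
    (forall x, ~~ prefix (rcons u i) x -> f x = x) /\
    (forall s, f (rcons u i ++ s) = u ++ s).
  exists (graft (rcons u i) u).
  by split=> [x|s]; [apply: graft_id|apply: graft_cat].
pose A := (N `\ u)%fset.
have AsubN x : x \in (A `|` L)%fset -> x \in (N `|` L)%fset.
  by rewrite !inE => /orP[/andP[_ ->]//|->]; rewrite orbT.
have uAL : u \notin (A `|` L)%fset.
  by rewrite !inE eqxx /= (shape_notin NL).
have below x : x \in (A `|` L)%fset -> prefix u x -> prefix (rcons u i) x.
  move=> xAL /prefixP[[|j s] E]; first by rewrite E cats0 (negbTE uAL) in xAL.
  have ujs : rcons u j ++ s = x by rewrite cat_rcons E.
  have /uniq_child <- : rcons u j \in (N `|` L)%fset.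
    case: (eqVneq s [::]) => [s0|s0].
      by move: ujs; rewrite s0 cats0 => ->; apply: AsubN.
    by rewrite inE (shape_cat NL _ _ s0) // ujs AsubN.
  by rewrite -ujs prefix_prefix.
have finj : {in (A `|` L)%fset &, injective f}.
  (* Here [f x] lies below [u]; a node [y] of [A] or [L] that [f] fixes and that lies below [u]
     would by [below] lie below [rcons u i]. *)
  have mix x y : y \in (A `|` L)%fset -> ~~ prefix (rcons u i) y ->
      prefix (rcons u i) x -> f x = f y -> x = y.
    move=> yAL ny /prefixP[s ->]; rewrite (fNdown y) // fup => E.
    by move/negP: ny; case; apply: below => //; rewrite -E prefix_prefix.
  move=> x y xAL yAL.
  have [px|nx] := boolP (prefix (rcons u i) x);
    have [py|ny] := boolP (prefix (rcons u i) y).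
  - move: px py => /prefixP[s ->] /prefixP[t ->]; rewrite !fup.
    by move=> /eqP; rewrite eqseq_cat // => /andP[_ /eqP->].
  - exact: mix.
  - by move=> E; apply/esym/mix.
  - by rewrite !fNdown.
have shape' : shape (f @` A)%fset (f @` L)%fset.
  apply: shape_image => //.
  - apply/fdisjointP => x; rewrite !inE => /andP[_ xN].
    exact: shape_notin xN.
  - case: (eqVneq u [::]) => [u0|u0]; last first.
      apply/imfsetP; exists [::]; last first.
        by rewrite fNdown // prefixs0 -size_eq0 size_rcons.
      by have := shape_root _ _ NL; rewrite !inE eq_sym u0.
    (* When [u] is the root, the new root is the image of [rcons u i]. That node is in the tree
       because there is a terminal, necessarily at or below it. *)
    have : (0 < #|` L|)%N by rewrite Ln.
    rewrite cardfs_gt0 => /fset0Pn[t tL].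
    have pt : prefix (rcons u i) t.
      by apply: below; rewrite ?inE ?tL ?orbT // u0 prefix0s.
    apply/imfsetP; exists (rcons u i); last first.
      by rewrite /= -[rcons u i]cats0 fup u0.
    rewrite /= !inE; move: pt => /prefixP[s E].
    have -> /= : rcons u i != u.
      by apply/negP => /eqP/(congr1 size); rewrite size_rcons => /esym/n_Sn.
    case: (eqVneq s [::]) => [s0|s0].
      by rewrite -[rcons u i]cats0 -s0 -E tL orbT.
    by rewrite (shape_cat NL _ _ s0) // -E inE tL orbT.
  - move=> x y j xAL; have [/prefixP[s E]|nx] := boolP (prefix (rcons u i) x).
      rewrite E fup; elim/last_ind: s E => [|s k _] E.
        rewrite cats0 => uy; apply/imfsetP; exists y => /=.
          rewrite !inE; apply/andP; split.
            by apply/negP => /eqP/(congr1 size); rewrite uy size_rcons => /n_Sn.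
          by apply: (shape_parent _ _ NL _ j); rewrite -uy inE uN.
        rewrite fNdown //; apply/negP => /size_prefix.
        by rewrite uy !size_rcons ltnNge leqnSn.
      rewrite -rcons_cat => /rcons_inj[<- _].
      apply/imfsetP; exists (rcons u i ++ s) => /=; last by rewrite fup.
      rewrite !inE; apply/andP; split.
        by apply/negP => /eqP/(congr1 size); rewrite size_cat size_rcons addSn
          => /eqP; rewrite gtn_eqF // ltnS leq_addr.
      by apply: (shape_parent _ _ NL _ k); rewrite rcons_cat -E AsubN.
    rewrite fNdown // => E; apply/imfsetP; exists y => /=.
      rewrite !inE; apply/andP; split.
        apply/negP => /eqP yu; move/negP: nx; apply.
        by rewrite E yu (uniq_child j) ?prefix_refl // -yu -E AsubN.
      by apply: (shape_parent _ _ NL _ j); rewrite -E AsubN.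
    rewrite fNdown //; apply: contra nx => /prefix_trans; apply.
    by rewrite E prefix_rcons.
have finjL : {in L &, injective f}.
  by move=> x y xL yL; apply: finj; rewrite inE ?xL ?yL orbT.
have finjA : {in A &, injective f}.
  by move=> x y xL yL; apply: finj; rewrite inE ?xL ?yL.
(* The contracted tree costs no more but has only m - 1 non-terminals. *)
have: (m <= #|` (f @` A)%fset|)%N.
  apply: nmin shape' _ _; first by rewrite card_in_imfset.
  rewrite fcost_image //; apply: ler_sum => x _.
  have [/prefixP[s ->]|nx] := boolP (prefix (rcons u i) x).
    by rewrite fup !depth_cat depth_rcons lerD2r lerDl.
  by rewrite fNdown.
by rewrite card_in_imfset //= -Nm (cardfsD1 u N) uN add1n ltnn.
Qed.

(** * Exchanging the subtrees at two nodes *)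

(** Descend from [w] through children: lengths in the finite set [N] are bounded, so the descent
    must leave [N], and it does so at a terminal. *)
Lemma terminal_below {r : nat} (N L : {fset node r}) (w : node r) :
  shape N L ->
  (forall u, u \in N -> exists i, rcons u i \in (N `|` L)%fset) ->
  w \in N -> exists2 t, t \in L & prefix w t.
Proof.
move=> NL child; have [k] : exists k, forall x, x \in N -> (size x <= k)%N.
  exists (\max_(x <- N) size x)%N => x xN.
  exact: (@leq_bigmax_seq _ _ _ _ _ xN).
move=> bound; have [d] := ubnP (k - size w).
elim: d w => // d IH w; rewrite ltnS => le wN.
have [i] := child _ wN; rewrite inE => /orP[wiN|wiL]; last first.
  by exists (rcons w i) => //; rewrite prefix_rcons.
have [||t tL wt] := IH (rcons w i) => //.
  have := bound _ wiN; rewrite size_rcons => lt.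
  by rewrite subnS prednK ?subn_gt0.
by exists t => //; apply: prefix_trans wt; rewrite prefix_rcons.
Qed.

Lemma sum_indicator {R : realType} {T : choiceType} (L : {fset T}) (t : T)
    (d : R) :
  \sum_(x <- L) (if x == t then d else 0) = if t \in L then d else 0.
Proof.
have [tL|tL] := boolP (t \in L).
  rewrite (big_fsetD1 t) //= eqxx big_seq big1 ?addr0 // => x.
  by rewrite !inE => /andP[/negbTE-> _].
rewrite big_seq big1 // => x xL; case: eqP xL => // ->.
by rewrite (negbTE tL).
Qed.

(** Climb from [x] towards the root until the parent is in [N']. This locates the position that an
    exchange fills with a non-terminal. *)
Lemma exists_frontier {r : nat} (N N' : {fset node r}) (x : node r) :
  (forall (v : node r) (i : 'I_r), rcons v i \in N -> v \in N) ->
  [::] \in N' -> x \in N -> x \notin N' ->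
  exists v i, [/\ rcons v i \in N, rcons v i \notin N' & v \in N'].
Proof.
move=> par rt; elim/last_ind: x => [|v i IH]; first by rewrite rt.
move=> viN viN'; have [vN'|vN'] := boolP (v \in N'); first by exists v, i.
exact: IH (par _ _ viN) vN'.
Qed.

(** The position [rcons v i] holds a terminal or nothing, so no descendant is left stranded when it
    trades places with [w]; its parent [v] lies outside both subtrees and stays a non-terminal. *)
Lemma swap_shape {r : nat} (N L : {fset node r}) (v w : node r) (i : 'I_r) :
  shape N L -> v \in N -> rcons v i \notin N -> w \in N ->
  ~~ prefix w (rcons v i) ->
  shape (subtree_swap (rcons v i) w @` N)%fset
        (subtree_swap (rcons v i) w @` L)%fset.
Proof.
move=> NL vN; have: prefix v (rcons v i) by rewrite prefix_rcons.
have: rcons v i != [::] by rewrite -size_eq0 size_rcons.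
have: forall y j, rcons v i = rcons y j -> y = v.
  by move=> y j /rcons_inj[-> _].
move: (rcons v i) => u uE u0 vu uN wN wu.
have uw : ~~ prefix u w by apply: contra uN => /(shape_prefix NL); apply.
have swapfix x : ~~ prefix u x -> ~~ prefix w x ->
    x \in N -> x \in (subtree_swap u w @` N)%fset.
  by move=> ux wx xN; apply/imfsetP; exists x; rewrite ?subtree_swap_id.
have vfix : v \in (subtree_swap u w @` N)%fset.
  apply: swapfix => //.
    by apply: contra uN => uv; apply: shape_prefix NL _ _ uv vN.
  by apply: contra wu => /prefix_trans; apply.
apply: shape_image.
- exact: shape_disj NL.
- by move=> x y _ _; apply: (can_inj (subtree_swapK uw wu)).
- apply/imfsetP; exists [::]; first exact: shape_root NL.
  rewrite subtree_swap_id // prefixs0 //.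
  by apply: contra wu => /eqP->; rewrite prefix0s.
- move=> x y j xNL; have [/prefixP[s E]|ux] := boolP (prefix u x).
    rewrite E in xNL *.
    (* Nothing in the tree lies strictly below [u], so [x] is [u] itself, sent to [w]; the parent of
       [w] is fixed by the swap. *)
    case: (eqVneq s [::]) => [s0|/(shape_cat NL)]; last first.
      by move=> /(_ u xNL); rewrite (negbTE uN).
    rewrite s0 subtree_swapl cats0 => wE.
    apply: swapfix.
    + by apply: contra uw => /prefix_trans; apply; rewrite wE prefix_rcons.
    + by apply/negP => /size_prefix; rewrite wE size_rcons ltnn.
    + by apply: (shape_parent _ _ NL _ j); rewrite -wE inE wN.
  have [/prefixP[s E]|wx] := boolP (prefix w x).
    rewrite E in xNL *; rewrite subtree_swapr //.
    elim/last_ind: s xNL {E} => [_|s k _ xNL]; first by rewrite cats0 => /uE->.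
    rewrite -rcons_cat => /rcons_inj[<- _]; apply/imfsetP; exists (w ++ s).
      by apply: (shape_parent _ _ NL _ k); rewrite rcons_cat.
    by rewrite subtree_swapr.
  rewrite subtree_swap_id // => xE; apply: swapfix.
  + by apply: contra ux => /prefix_trans; apply; rewrite xE prefix_rcons.
  + by apply: contra wx => /prefix_trans; apply; rewrite xE prefix_rcons.
  + by apply: (shape_parent _ _ NL _ j); rewrite -xE.
Qed.

(* Some terminal t lies below w, so the only terminal that can get deeper,
   u itself, is compensated by t. *)
Lemma swap_cost {R : realType} {r : nat} (c : 'I_r -> R)
    (N L : {fset node r}) (u w t : node r) :
  shape N L -> u \notin N -> w \in N -> ~~ prefix w u -> t \in L ->
  prefix w t -> depth c u <= depth c w ->
  fcost c (subtree_swap u w @` L)%fset <= fcost c L.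
Proof.
move=> NL uN wN wu tL wt duw.
have uw : ~~ prefix u w by apply: contra uN => /(shape_prefix NL); apply.
rewrite fcost_image; last first.
  by move=> x y _ _; apply: (can_inj (subtree_swapK uw wu)).
pose d := depth c w - depth c u; have d0 : 0 <= d by rewrite subr_ge0.
(* Pointwise bound: add [d] at [u], subtract [d] at [t], and ignore the gain at any other terminal
   below [w]. *)
apply: (@le_trans _ _ (\sum_(x <- L) (depth c x +
    ((if x == u then d else 0) - (if x == t then d else 0))))).
  rewrite big_seq [leRHS]big_seq; apply: ler_sum => x xL.
  have [/prefixP[s E]|ux] := boolP (prefix u x).
    have s0 : s = [::].
      apply/eqP/negPn/negP => s0; move/negP: uN; apply.
      by apply: (shape_cat NL _ _ s0); rewrite -E inE xL orbT.
    have -> : x = u by rewrite E s0 cats0.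
    rewrite eqxx; case: eqP => [ut|_]; first by rewrite ut wt in wu.
    have -> : subtree_swap u w u = w.
      by rewrite -[X in subtree_swap _ _ X]cats0 subtree_swapl cats0.
    by rewrite subr0 /d subrKC.
  have -> : (x == u) = false.
    by apply/negP => /eqP xu; rewrite xu prefix_refl in ux.
  have [/prefixP[s E]|wx] := boolP (prefix w x).
    have -> : depth c (subtree_swap u w x) = depth c x - d.
      by rewrite E subtree_swapr // !depth_cat /d; lra.
    by case: eqP => _; lra.
  rewrite subtree_swap_id // sub0r ifN ?oppr0 ?addr0 //.
  by apply: contra wx => /eqP->.
rewrite big_split /= sumrB !sum_indicator tL -/(fcost c L) gerDl.
by case: ifP => _; rewrite ?subrr // sub0r oppr_le0.
Qed.

(** Induction on the number of nodes of [N] missing from [M]. Only the non-terminals are steered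
    towards [N]; the terminals [L'] are whatever the exchanges produce. *)
Lemma minimal_exchange {R : realType} {r n m : nat} (c : 'I_r -> R)
    (N M L : {fset node r}) :
  (1 <= n)%N -> (forall j, 0 <= c j) ->
  (forall (v : node r) (i : 'I_r), rcons v i \in N -> v \in N) ->
  #|` N| = m ->
  (forall u w, u \in N -> w \notin N -> depth c u <= depth c w) ->
  minimal c n m M L -> exists L', minimal c n m N L'.
Proof.
move=> n1 c0 Npar Nm Nle; have [k] := ubnP #|` N `\` M|%fset.
elim: k M L => // k IH M L; rewrite ltnS => lek ML.
have [ML' _ Mm _ _] := ML.
have Nprefix x y : prefix x y -> y \in N -> x \in N.
  move=> /prefixP[s ->]; elim/last_ind: s => [|s j IHs]; first by rewrite cats0.
  by rewrite -rcons_cat => /Npar.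
have [NM|NM] := boolP (N `<=` M)%fset.
  suff -> : N = M by exists L.
  by apply/eqP; rewrite eqEfcard NM Nm Mm /=.
have [w wM wN] : exists2 w, w \in M & w \notin N.
  apply/fsubsetPn; apply: contra NM => MN.
  by have /eqP -> : M == N by rewrite eqEfcard MN Nm Mm /=.
have rM : [::] \in M by apply: shape_prefix ML' _ _ (prefix0s _) wM.
have /fsubsetPn[x xN xM] := NM.
have [v [i [uN uM vM]]] := exists_frontier _ _ _ Npar rM xN xM.
have duw := Nle _ _ uN wN.
have wu : ~~ prefix w (rcons v i).
  by apply: contra wN => /Nprefix; apply.
have uw : ~~ prefix (rcons v i) w.
  by apply: contra uM => /(shape_prefix ML'); apply.
have [t tL wt] : exists2 t, t \in L & prefix w t.
  apply: terminal_below ML' _ wM => y yM.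
  have [j _ yj] := minimal_proper c M L y i c0 n1 ML yM.
  by exists j.
have finj := can_inj (subtree_swapK uw wu).
apply: (IH (subtree_swap (rcons v i) w @` M)%fset
           (subtree_swap (rcons v i) w @` L)%fset).
  (* The swap brings [rcons v i] into the non-terminals and fixes every node of both [N] and [M]:
     such a node is not below [w], which is outside [N], nor below [rcons v i], which is outside
     [M]. *)
  apply: leq_trans lek.
  rewrite (cardfsD1 (rcons v i) (N `\` M)%fset) in_fsetD uM uN ltnS.
  apply/fsubset_leq_card/fsubsetP => y; rewrite !in_fsetE => /andP[yM yN].
  rewrite yN andbT; apply/andP; split.
    apply: contra yM => /eqP->; apply/imfsetP; exists w => //.
    by rewrite -[X in subtree_swap _ _ X]cats0 subtree_swapr // cats0.
  apply: contra yM => yM; apply/imfsetP; exists y => //.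
  rewrite subtree_swap_id //; last by apply: contra wN => /Nprefix; apply.
  by apply: contra uM => /(shape_prefix ML'); apply.
apply: (minimal_of_le c M L _ _ ML).
- exact: swap_shape.
- by rewrite card_imfset //=; case: ML.
- by rewrite card_imfset.
- exact: (swap_cost c M L _ w t).
Qed.

(** * Best choice of terminals for given non-terminals *)

Lemma ler_sum_size {R : realType} {T : eqType} (F : T -> R) (s t : seq T) :
  size s = size t -> (forall x y, x \in s -> y \in t -> F x <= F y) ->
  \sum_(x <- s) F x <= \sum_(y <- t) F y.
Proof.
elim: s t => [|x s IH] [|y t] //= [st] le; rewrite ?big_nil // !big_cons.
apply: lerD; first by apply: le; rewrite mem_head.
by apply: IH => // a b a_s b_t; apply: le; rewrite inE ?a_s ?b_t orbT.
Qed.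

(** The common part cancels, and the two differences have equal size, so any pairing of their
    elements will do. *)
Lemma ler_sum_fsetD {R : realType} {T : choiceType} (F : T -> R)
    (A B : {fset T}) :
  #|` A| = #|` B| ->
  (forall x y, x \in A -> y \in (B `\` A)%fset -> F x <= F y) ->
  \sum_(x <- A) F x <= \sum_(y <- B) F y.
Proof.
have sumID (X Y : {fset T}) : \sum_(x <- X) F x =
    \sum_(x <- (X `&` Y)%fset) F x + \sum_(x <- (X `\` Y)%fset) F x.
  rewrite (big_fsetID _ (mem Y)); congr (_ + _); congr (bigop _ _ _);
    by congr enum_fset; apply/fsetP => x; rewrite !inE // andbC.
move=> AB le; rewrite (sumID A B) (sumID B A) fsetIC lerD2l.
apply: ler_sum_size => [|x y]; first by rewrite !cardfsD AB fsetIC.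
by rewrite inE => /andP[_ xA]; apply: le.
Qed.

Lemma minimal_terminals {R : realType} {r n m : nat} (c : 'I_r -> R)
    (N L L' : {fset node r}) :
  minimal c n m N L -> shape N L' -> #|` L'| = n ->
  (forall u v i, u \in L' -> v \in N -> rcons v i \notin (N `|` L')%fset ->
     depth c u <= depth c (rcons v i)) ->
  minimal c n m N L'.
Proof.
move=> NLmin NL' Ln' Lle; have [NL Ln Nm _ _] := NLmin.
apply: (minimal_of_le c N L _ _ NLmin) => //.
apply: ler_sum_fsetD => [|u w uL']; first by rewrite Ln Ln'.
rewrite in_fsetD => /andP[wL' wL].
have wN : w \notin N by apply: contraL wL; apply: shape_notin.
(* The root belongs to [N] or [L'], so [w] has a parent. *)
case/lastP: w wL wL' wN => [|v i] wL wL' wN.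
  by have := shape_root _ _ NL'; rewrite inE (negbTE wN) (negbTE wL').
apply: Lle => //; last by rewrite inE negb_or wN.
by apply: (shape_parent _ _ NL _ i); rewrite inE wL orbT.
Qed.

(** * From shapes back to trees *)

Theorem lemma2p4 (R : realType) (r n : nat) (hr : (2 <= r)%N) (hn : (1 <= n)%N)
    (c : 'I_r -> R) (c_ge0 : forall i : 'I_r, 0 <= c i)
    (c_mono : forall i j : 'I_r, (i <= j)%N -> c i <= c j)
    (m : nat) (hm : @min_nonterminals R r n c m)
    (T : tree r n) (T_shallow : shallow c T)
    (T_m : nonterminals T #= `I_m) :
  optimal c T /\ proper_tree T.
Proof.
have [[To [To_opt To_m]] m_min] := hm; have [T_le T_leaf] := T_shallow.
have [M [ML ME Mm]] := tree_shape _ To_m.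
have [N [NL NE Nm]] := tree_shape _ T_m.
have memN u : u \in N <-> nonterminals T u by rewrite -NE.
have memNL u : u \in (N `|` terminals T)%fset <-> nodes T u.
  rewrite inE; split=> [/orP[/memN[]//|/terminals_in//]|uT].
  have [uL|uL] := boolP (u \in terminals T); first by rewrite orbT.
  by rewrite orbF; apply/memN; split.
have Mmin : minimal c n m M (terminals To).
  split=> //; first exact: card_terminals.
    by move=> N' L' NL' /(shape_tree _ _ NL')[T' <- _]; apply: To_opt.
  move=> N' L' NL' /(shape_tree _ _ NL')[T' T'L T'N] le.
  apply: (m_min T'); last by rewrite T'N; apply/card_eq_fsetP.
  by move=> T2; apply: le_trans (To_opt T2); rewrite /cost T'L.
have [L NLmin] : exists L, minimal c n m N L.
  apply: (minimal_exchange c) Mmin => //.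
    by move=> v i viN; apply: (shape_parent _ _ NL _ i); rewrite inE viN.
  move=> u w /memN uN wN; apply: T_le => // /memN.
  exact/negP.
have Tmin : minimal c n m N (terminals T).
  apply: minimal_terminals NLmin NL (card_terminals T) _ => u v i uL vN viT.
  by apply: T_leaf => //; [apply/memN|move/memNL; apply/negP].
split.
  (* [Tmin] only compares with finite shapes, whereas [T'] may have infinitely many non-terminals;
     passing through [To] bridges this. *)
  move=> T'; apply: le_trans (To_opt T'); apply: (minimal_cost _ _ _ _ _ Tmin).
    exact: ML.
  exact: card_terminals.
move=> u /memN uN.
(* The letter [Ordinal hr], of index 1, is an arbitrary choice: at first any child will do, and the
   next use gives a different one. *)
have [i _ /memNL ui] := minimal_proper c N _ u (Ordinal hr) c_ge0 hn Tmin uN.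
have [j ji /memNL uj] := minimal_proper c N _ u i c_ge0 hn Tmin uN.
by exists j, i.
Qed.
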